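(* Let $(X,G,W)$ be a convex $G$-metric space with a convex structure $W$, and let $T:X\to X$ be a mapping with a fixed point $u$ satisfying $$G(Tx,Ty,Tz)\le a\,G(x,y,z)+b\,\{G(x,Tx,Tx)+G(y,Ty,Ty)+G(z,Tz,Tz)\}$$ for all $x,y,z\in X$, where $a,b$ are nonnegative real numbers with $0<a+3b<1$. Let $x_0\in X$, let $\{\alpha_n\}_{n\ge 0}\subset[0,1]$ satisfy $\sum_{n=0}^{\infty}\alpha_n=\infty$, and let $\{x_n\}$ be the Mann iterative process defined by $$x_{n+1}=W(x_n,Tx_n;1-\alpha_n,\alpha_n),\qquad n=0,1,2,\dots.$$ Then $\{x_n\}$ converges strongly to a fixed point of $T$.
   Context: A $G$-metric space is a pair $(X,G)$ where $X$ is a nonempty set and $G:X\times X\times X\to[0,\infty)$ satisfies: (i) $G(x,y,z)=0$ if $x=y=z$; (ii) $0<G(x,x,y)$ for all $x,y\in X$ with $x\ne y$; (iii) $G(x,x,y)\le G(x,y,z)$ for all $x,y,z\in X$ with $z\ne y$; (iv) $G$ is symmetric in all three variables; (v) $G(x,y,z)\le G(x,a,a)+G(a,y,z)$ for all $x,y,z,a\in X$. A convex structure on a $G$-metric space $(X,G)$ is a mapping $W:X^2\times I^2\to X$, with $I=[0,1]$, such that $G(W(x,y;\lambda,\beta),u,v)\le\lambda G(x,u,v)+\beta G(y,u,v)$ for all $x,y,u,v\in X$ and all $\lambda,\beta\in I$ with $\lambda+\beta=1$. The triple $(X,G,W)$ is then called a convex $G$-metric space. A sequence $\{x_n\}$ in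 $X$ converges (strongly, i.e. $G$-converges) to $x\in X$ if $\lim_{n,m\to\infty}G(x,x_n,x_m)=0$; equivalently, $G(x_n,x,x)\to0$ as $n\to\infty$. *)

(* Defs.v *)
From mathcomp Require Export all_boot all_order all_algebra.
From mathcomp Require Export all_classical all_reals all_analysis.

Set Implicit Arguments.
Unset Strict Implicit.
Unset Printing Implicit Defensive.

Export Order.TTheory GRing.Theory Num.Theory.
Export numFieldNormedType.Exports.

Global Open Scope classical_set_scope.
Global Open Scope ring_scope.

(* The two transpositions generate all permutations of the three variables. *)
Record is_Gmetric (R : realType) (X : Type) (G : X -> X -> X -> R) : Prop := {
  Gmetric_inhabited : inhabited X ;
  Gmetric_ge0 : forall x y z, 0 <= G x y z ;
  Gmetric_eq0 : forall x, G x x x = 0 ;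
  Gmetric_gt0 : forall x y, x <> y -> 0 < G x x y ;
  Gmetric_le : forall x y z, z <> y -> G x x y <= G x y z ;
  Gmetric_sym12 : forall x y z, G x y z = G y x z ;
  Gmetric_sym23 : forall x y z, G x y z = G x z y ;
  Gmetric_rect : forall x y z a, G x y z <= G x a a + G a y z }.

Definition is_convex_structure (R : realType) (X : Type)
    (G : X -> X -> X -> R) (W : X -> X -> {i01 R} -> {i01 R} -> X) : Prop :=
  forall (x y u v : X) (l b : {i01 R}), l%:num + b%:num = 1 ->
    G (W x y l b) u v <= l%:num * G x u v + b%:num * G y u v.

Record is_convex_Gmetric (R : realType) (X : Type) (G : X -> X -> X -> R)
    (W : X -> X -> {i01 R} -> {i01 R} -> X) : Prop := {
  convex_Gmetric_Gmetric : is_Gmetric G ;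
  convex_Gmetric_structure : is_convex_structure G W }.

Definition is_Mann_iteration (R : realType) (X : Type)
    (W : X -> X -> {i01 R} -> {i01 R} -> X) (T : X -> X)
    (alpha : nat -> {i01 R}) (x0 : X) (x : nat -> X) : Prop :=
  x 0%N = x0 /\
  forall n, x n.+1 = W (x n) (T (x n)) (1 - (alpha n)%:num)%:i01 (alpha n).

Definition Gconverges (R : realType) (X : Type) (G : X -> X -> X -> R)
    (x : nat -> X) (p : X) : Prop :=
  G p (x nm.1) (x nm.2) @[nm --> (\oo, \oo)] --> (0 : R).

(* Main.v *)
Require Import Defs.
From mathcomp Require Import ring lra.

(** The limit is the given fixed point [u] itself.  The distance to [u] is
    measured by [d x := G x u u].

    Inserting [Tu = u] in the contractive condition bounds [d (T x)] by
    [a * d x + b * G x (T x) (T x)], and the rectangle inequality through [u]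
    bounds [G x (T x) (T x)] by [d x + 2 * d (T x)].  Absorbing the term in
    [d (T x)] gives [(1 - 2 * b) * d (T x) <= (a + b) * d x], a strict
    contraction towards [u] precisely because [a + 3 * b < 1]
    ([fixpoint_quasi_contraction]).

    Convexity then turns one Mann step into
    [d_(n+1) <= d_n - c * alpha_n * d_n] for a constant [c > 0].  Such a sequence
    tends to [0] when the [alpha_n] have a divergent sum ([damped_cvg0]).
    Finally [G u x_n x_m <= d_n + d_m], so the vanishing of [d_n] is
    [G]-convergence to [u] ([Gconverges_of_dist]). *)

Lemma Gmetric_rect_center {R : realType} {X : Type} {G : X -> X -> X -> R}
    (hG : is_Gmetric G) (u y z : X) : G u y z <= G y u u + G z u u.
Proof.
rewrite (Gmetric_sym12 hG u y z).
apply: le_trans (Gmetric_rect hG y u z u) _.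
by rewrite (Gmetric_sym23 hG u u z) (Gmetric_sym12 hG u z u).
Qed.

Lemma Gmetric_rect_pair {R : realType} {X : Type} {G : X -> X -> X -> R}
    (hG : is_Gmetric G) (u y z : X) : G y z z <= G y u u + 2 * G z u u.
Proof.
apply: le_trans (Gmetric_rect hG y z z u) _.
by rewrite lerD2l (le_trans (Gmetric_rect_center hG u z z)) // mulr_natl.
Qed.

(** The double limit required by the definition reduces to a single one,
    since [G p x_n x_m] is dominated by a sum of a term in [n] and one in [m]. *)
Lemma Gconverges_of_dist {R : realType} {X : Type} {G : X -> X -> X -> R}
    (hG : is_Gmetric G) (x : nat -> X) (p : X) :
  G (x n) p p @[n --> \oo] --> (0 : R) -> Gconverges G x p.
Proof.
move=> d0.
have sum0 : G (x nm.1) p p + G (x nm.2) p p @[nm --> (\oo, \oo)] --> (0 : R).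
  rewrite -[X in _ --> X](addr0 (0 : R)); apply: cvgD.
    exact: (cvg_comp _ _ cvg_fst d0).
  exact: (cvg_comp _ _ cvg_snd d0).
apply: (squeeze_cvgr _ (cvg_cst (0 : R)) sum0).
apply: nearW => nm.
by rewrite (Gmetric_ge0 hG) (Gmetric_rect_center hG).
Qed.

(** The coefficient [2] in the bound on [G x (T x) (T x)] comes from comparing
    [G u (T x) (T x)] with [G (T x) u u]; it is what makes the threshold
    [a + 3 * b < 1] the natural one. *)
Lemma fixpoint_quasi_contraction {R : realType} {X : Type} {G : X -> X -> X -> R}
    (hG : is_Gmetric G)
    (T : X -> X) (u : X) (a b : R) :
  T u = u -> 0 <= b ->
  (forall x y z : X,
    G (T x) (T y) (T z) <=
      a * G x y z + b * (G x (T x) (T x) + G y (T y) (T y) + G z (T z) (T z))) ->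
  forall x, (1 - 2 * b) * G (T x) u u <= (a + b) * G x u u.
Proof.
move=> hu hb hT x.
have := hT x u u; rewrite hu (Gmetric_eq0 hG) !addr0 => Px.
have := ler_wpM2l hb (Gmetric_rect_pair hG u x (T x)).
lra.
Qed.

(** Summing [c * s_i * d_i <= d_i - d_(i+1)] telescopes to [d_0 - d_n]; as [d]
    is nonincreasing, each [d_i] on the left may be lowered to [d_n], which
    leaves [c * d_n * (s_0 + ... + s_(n-1)) <= d_0].  The rate
    [1 / (s_0 + ... + s_(n-1))] suffices, so no infinite product of the factors
    [1 - c * s_i] has to be estimated. *)
Lemma damped_cvg0 {R : realType} {c : R} {s d : nat -> R} :
  0 < c -> (forall n, 0 <= s n) -> (forall n, 0 <= d n) ->
  (forall n, d n.+1 <= d n - c * s n * d n) ->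
  series s n @[n --> \oo] --> +oo ->
  d n @[n --> \oo] --> (0 : R).
Proof.
move=> c0 s0 d0 hd sumoo.
have csd n : 0 <= c * s n by rewrite mulr_ge0 // ltW.
have bound n : c * series s n * d n <= d 0%N - d n.
  elim: n => [|n IHn]; first by rewrite /series /= big_geq // mulr0 mul0r subrr.
  rewrite seriesSr.
  have S0 : 0 <= c * (series s n + s n).
    apply: mulr_ge0; first exact: ltW.
    by apply: addr_ge0 => //; apply: sumr_ge0.
  have dS : d n.+1 <= d n.
    by apply: le_trans (hd n) _; rewrite gerBl mulr_ge0.
  have := ler_wpM2l S0 dS.
  have := hd n.
  lra.
have inv0 : (d 0%N / c) * (series s n)^-1 @[n --> \oo] --> (0 : R).
  rewrite -[X in _ --> X](mulr0 (d 0%N / c)); apply: cvgMr.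
  apply/gtr0_cvgV0; last exact: sumoo.
  by move/cvgryPgt: sumoo => /(_ 0).
apply: (squeeze_cvgr _ (cvg_cst (0 : R)) inv0).
(* The bound divides by the partial sum, which is positive only eventually. *)
move/cvgryPgt: sumoo => /(_ 0); apply: filterS => n S0.
rewrite d0 /= -mulrA -invfM ler_pdivlMr ?mulr_gt0 //.
by rewrite mulrC (le_trans (bound n)) // gerBl.
Qed.

Theorem corollary2p2 (R : realType) (X : Type) (G : X -> X -> X -> R)
    (W : X -> X -> {i01 R} -> {i01 R} -> X)
    (hGW : is_convex_Gmetric G W)
    (T : X -> X) (u : X) (hu : T u = u)
    (a b : R) (ha : 0 <= a) (hb : 0 <= b)
    (hab : 0 < a + 3 * b < 1)
    (hT : forall x y z : X,
      G (T x) (T y) (T z) <=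
        a * G x y z + b * (G x (T x) (T x) + G y (T y) (T y) + G z (T z) (T z)))
    (x0 : X) (alpha : nat -> {i01 R})
    (halpha : series (fun n => (alpha n)%:num) n @[n --> \oo] --> +oo)
    (x : nat -> X) (hx : is_Mann_iteration W T alpha x0 x) :
  exists p : X, T p = p /\ Gconverges G x p.
Proof.
have [hG hW] := hGW; have [_ xS] := hx.
exists u; split=> //; apply: (Gconverges_of_dist hG).
have e0 : 0 < 1 - 2 * b by lra.
(* [1 - c] is the contraction factor [(a + b) / (1 - 2 * b)]. *)
pose c := (1 - a - 3 * b) / (1 - 2 * b).
have c0 : 0 < c by rewrite divr_gt0 //; lra.
have contr y : G (T y) u u <= (1 - c) * G y u u.
  rewrite -(ler_pM2l e0) mulrA.
  have -> : (1 - 2 * b) * (1 - c) = a + b by rewrite /c; field; rewrite gt_eqF.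
  exact: (fixpoint_quasi_contraction hG _ _ _ _ hu hb hT).
apply: (damped_cvg0 c0 _ _ _ halpha) => n //.
  exact: Gmetric_ge0 hG _ _ _.
rewrite xS.
apply: le_trans (hW _ _ u u _ _ _) _; first by rewrite /= subrK.
have al0 : 0 <= (alpha n)%:num by [].
have := ler_wpM2l al0 (contr (x n)).
rewrite /=; lra.
Qed.
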